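(* Let $\Sigma$ be a vertical surface in $\mathbb{S}^2\times\mathbb{R}$. Then $\Sigma$ is a $V$-soliton, where $V=\partial_t$, if and only if its generating curve is a geodesic of $\mathbb{S}^2$ and $\Sigma$ is a vertical surface on a geodesic of $\mathbb{S}^2$.
   Context: $\mathbb{S}^2$ is the unit sphere of $\mathbb{R}^3$, and $\mathbb{S}^2\times\mathbb{R}\subset\mathbb{R}^4$ carries the product metric with coordinates $(x,y,z,t)$, where $x^2+y^2+z^2=1$. $V=\partial_t$ is the Killing field tangent to the fibers of $\mathbb{S}^2\times\mathbb{R}\to\mathbb{S}^2$. The mean curvature $H$ of a surface is the sum of its principal curvatures with respect to a unit normal $N$. A surface $\Sigma$ in $\mathbb{S}^2\times\mathbb{R}$ is a $V$-soliton if $H=\langle N,V\rangle$ on $\Sigma$. A vertical surface is a surface $\Sigma$ invariant under all vertical translations $T_\lambda(p,t)=(p,t+\lambda)$, $\lambda\in\mathbb{R}$; its generating curve is a regular curve $\alpha:I\subset\mathbb{R}\to\mathbb{S}^2$ such that $\Sigma$ is parametrized by $(s,t)\mapsto(\alpha(s),t)$, $s\in I$, $t\in\mathbb{R}$. One says $\Sigma$ is a vertical surface on $\alpha$. A curve is called a geodesic here if its geodesic curvature in $\mathbb{S}^2$ vanishes (irrespective of its parametrization). *)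

(* Defs.v *)
From mathcomp Require Import all_boot all_order all_algebra.
From mathcomp Require Import all_classical all_reals all_analysis.

Set Implicit Arguments.
Unset Strict Implicit.
Unset Printing Implicit Defensive.

Import Order.TTheory GRing.Theory Num.Theory.
Import numFieldNormedType.Exports.

Local Open Scope classical_set_scope.
Local Open Scope ring_scope.

(* Class C^k, then C^oo, on an open set U of a finite-dimensional space. *)
Fixpoint Ck_on (R : realType) (V W : normedModType R) (k : nat)
    (U : set V) (f : V -> W) : Prop :=
  match k with
  | 0%N => forall p, U p -> {for p, continuous f}
  | k'.+1 => forall v : V,
      (forall p, U p -> derivable f p v) /\ Ck_on k' U ('D_v f)
  end.

Definition smooth_on (R : realType) (V W : normedModType R)
    (U : set V) (f : V -> W) : Prop := forall k, Ck_on k U f.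

(* The library norm of row vectors is the sup norm, hence an explicit
   Euclidean structure. *)
Definition dot (R : realType) (n : nat) (u v : 'rV[R]_n) : R :=
  \sum_(i < n) u ord0 i * v ord0 i.

Definition enorm (R : realType) (n : nat) (u : 'rV[R]_n) : R :=
  Num.sqrt (dot u u).

(* Coordinates are indexed by 'I_3, whose addition is modulo 3. *)
Definition cross (R : realType) (u v : 'rV[R]_3) : 'rV[R]_3 :=
  \row_(k < 3) (u ord0 (k + 1) * v ord0 (k + 2)
                - u ord0 (k + 2) * v ord0 (k + 1)).

(* Orthogonal projection onto the hyperplane orthogonal to the unit vector nu. *)
Definition tangential (R : realType) (n : nat) (nu v : 'rV[R]_n) : 'rV[R]_n :=
  v - dot v nu *: nu.

Definition S2 (R : realType) : set 'rV[R]_3 := [set x | dot x x = 1].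

(* R^4 is 'rV_(3 + 1): a point with coordinates (x, y, z, t) is
   row_mx (x, y, z) t. *)
Definition S2xR (R : realType) : set 'rV[R]_(3 + 1) :=
  [set p | S2 (lsubmx p)].

Definition vertical_field (R : realType) : 'rV[R]_(3 + 1) := row_mx 0 1%:M.

(* Unit normal of S2xR in R^4. *)
Definition S2xR_normal (R : realType) (p : 'rV[R]_(3 + 1)) : 'rV[R]_(3 + 1) :=
  row_mx (lsubmx p) 0.

Definition translation (R : realType) (lambda : R) (p : 'rV[R]_(3 + 1)) :
  'rV[R]_(3 + 1) := row_mx (lsubmx p) (rsubmx p + lambda%:M).

Section Patches.
Variables (R : realType).
Implicit Types (U : set 'rV[R]_2) (X : 'rV[R]_2 -> 'rV[R]_(3 + 1)).

Definition partial X (i : 'I_2) : 'rV[R]_2 -> 'rV[R]_(3 + 1) :=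
  'D_(delta_mx ord0 i) X.

Definition jacobian_rows X (p : 'rV[R]_2) : 'M[R]_(2, 3 + 1) :=
  \matrix_(i < 2) partial X i p.

(* A smooth immersion of a plane open set in S2xR, not necessarily injective. *)
Definition regular_patch U X : Prop :=
  [/\ open U,
      smooth_on U X,
      (forall p, U p -> S2xR (X p)) &
      (forall p, U p -> row_free (jacobian_rows X p))].

Definition unit_normal X (p : 'rV[R]_2) (N : 'rV[R]_(3 + 1)) : Prop :=
  [/\ dot N N = 1,
      dot N (S2xR_normal (X p)) = 0 &
      forall i, dot N (partial X i p) = 0].

Definition first_form X (p : 'rV[R]_2) : 'M[R]_2 :=
  \matrix_(i, j) dot (partial X i p) (partial X j p).

(* The Levi-Civita derivative of X_j along X_i is the tangential part, with
   respect to S2xR, of the derivative taken in R^4. *)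
Definition second_form X (p : 'rV[R]_2) (N : 'rV[R]_(3 + 1)) : 'M[R]_2 :=
  \matrix_(i, j)
    dot (tangential (S2xR_normal (X p)) (partial (partial X j) i p)) N.

(* Row i holds the coordinates of A X_i in the basis (X_0, X_1), where A is
   defined by <A v, w> = II(v, w). *)
Definition shape_operator X (p : 'rV[R]_2) (N : 'rV[R]_(3 + 1)) : 'M[R]_2 :=
  second_form X p N *m invmx (first_form X p).

(* k1 and k2 are the eigenvalues counted with multiplicity. *)
Definition principal_curvatures X (p : 'rV[R]_2) (N : 'rV[R]_(3 + 1))
    (k1 k2 : R) : Prop :=
  char_poly (shape_operator X p N) = ('X - k1%:P) * ('X - k2%:P).

Definition mean_curvature X (p : 'rV[R]_2) (N : 'rV[R]_(3 + 1)) (H : R) : Prop :=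
  exists k1 k2, principal_curvatures X p N k1 k2 /\ H = k1 + k2.

End Patches.

(* Images of immersed surfaces: self-intersections are allowed, since a
   generating curve need not be injective; countably many patches suffice
   because surfaces are second countable. *)
Definition surface (R : realType) (Sigma : set 'rV[R]_(3 + 1)) : Prop :=
  exists (U : nat -> set 'rV[R]_2) (X : nat -> 'rV[R]_2 -> 'rV[R]_(3 + 1)),
    (forall n, regular_patch (U n) (X n)) /\
    Sigma = \bigcup_n (X n @` U n).

(* The equation is invariant under N |-> - N, so it is imposed for both unit
   normals of every regular patch contained in Sigma. *)
Definition V_soliton (R : realType) (Sigma : set 'rV[R]_(3 + 1)) : Prop :=
  forall U X, regular_patch U X -> X @` U `<=` Sigma ->
  forall p N, U p -> unit_normal X p N ->
    mean_curvature X p N (dot N (vertical_field R)).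

Definition regular_curve (R : realType) (I : set R) (alpha : R -> 'rV[R]_3) :
    Prop :=
  [/\ is_interval I, open I, I !=set0, smooth_on (I : set R^o) alpha &
      forall s, I s -> S2 (alpha s) /\ derive1 alpha s != 0].

Definition unit_tangent (R : realType) (alpha : R -> 'rV[R]_3) (s : R) :
  'rV[R]_3 := (enorm (derive1 alpha s))^-1 *: derive1 alpha s.

(* <nabla_T T, J T> with nabla_T the covariant derivative of S2 with respect to
   arc length (whence the factor 1 / |alpha'|) and J T = alpha x T. *)
Definition geodesic_curvature (R : realType) (alpha : R -> 'rV[R]_3) (s : R) :
    R :=
  dot ((enorm (derive1 alpha s))^-1 *:
         tangential (alpha s) (derive1 (unit_tangent alpha) s))
      (cross (alpha s) (unit_tangent alpha s)).

Definition geodesic (R : realType) (I : set R) (alpha : R -> 'rV[R]_3) : Prop :=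
  forall s, I s -> geodesic_curvature alpha s = 0.

Definition vertical_surface (R : realType) (Sigma : set 'rV[R]_(3 + 1)) : Prop :=
  surface Sigma /\ forall lambda, translation lambda @` Sigma = Sigma.

Definition generating_curve (R : realType) (Sigma : set 'rV[R]_(3 + 1))
    (I : set R) (alpha : R -> 'rV[R]_3) : Prop :=
  regular_curve I alpha /\
  Sigma = [set row_mx (alpha s) t%:M | s in I & t in [set: R]].

Definition vertical_surface_on (R : realType) (Sigma : set 'rV[R]_(3 + 1))
    (I : set R) (alpha : R -> 'rV[R]_3) : Prop :=
  vertical_surface Sigma /\ generating_curve Sigma I alpha.

(* Main.v *)
Require Import Defs.
From mathcomp Require Import all_boot all_order all_algebra.
From mathcomp Require Import all_classical all_reals all_analysis.
From mathcomp Require Import ring lra.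

(** On the cylinder over a curve alpha, take the chart
    (s, t) |-> (alpha s, t).  Its unit normal is (n, 0), where
    n = alpha x T is the conormal of alpha and T its unit tangent; it is
    horizontal, so that <N, V> = 0 and being a V-soliton means being minimal.
    The second form has a single nonzero entry, <alpha'', n>, and dividing by
    |alpha'|^2 shows that the mean curvature is exactly the geodesic curvature
    of alpha ([vertical_patch_mean_curvature]).  A V-soliton therefore has a
    geodesic as generating curve.

    Conversely, the conormal of a geodesic is constant
    ([geodesic_conormal_constant]): its derivative is alpha x T', and T' has
    no component along T, because T is unit, nor along n, because alpha is a
    geodesic.  Hence alpha stays in the great circle orthogonal to some unit
    vector m, and the whole surface lies in the linear hyperplane of R^4
    orthogonal to (m, 0).  The soliton equation has to be checked on every
    immersed patch X of the surface, not only on the chart above, but no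
    relation between X and that chart is needed: all first and second
    derivatives of X stay in the hyperplane, and (m, 0) spans the normal line
    of X inside S2 x R by a dimension count.  So N is a multiple of (m, 0),
    the second form vanishes identically, and both sides of H = <N, V> are
    zero ([patch_in_vertical_hyperplane]). *)

Import Order.TTheory GRing.Theory Num.Theory.
Import numFieldNormedType.Exports.

Local Open Scope classical_set_scope.
Local Open Scope ring_scope.

(** * Euclidean algebra *)

Section EuclideanAlgebra.
Context {R : realType}.

Lemma dotC {n} (u v : 'rV[R]_n) : dot u v = dot v u.
Proof. by apply: eq_bigr => i _; rewrite mulrC. Qed.

Lemma dotDl {n} (u v w : 'rV[R]_n) : dot (u + v) w = dot u w + dot v w.
Proof. by rewrite -big_split; apply: eq_bigr => i _; rewrite mxE mulrDl. Qed.

Lemma dotZl {n} (a : R) (u v : 'rV[R]_n) : dot (a *: u) v = a * dot u v.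
Proof. by rewrite /dot mulr_sumr; apply: eq_bigr => i _; rewrite mxE mulrA. Qed.

Lemma dotBl {n} (u v w : 'rV[R]_n) : dot (u - v) w = dot u w - dot v w.
Proof. by rewrite -scaleN1r dotDl dotZl mulN1r. Qed.

Lemma dot0l {n} (u : 'rV[R]_n) : dot 0 u = 0.
Proof. by rewrite -[0](scale0r 0) dotZl mul0r. Qed.

Lemma dotZr {n} (a : R) (u v : 'rV[R]_n) : dot u (a *: v) = a * dot u v.
Proof. by rewrite !(dotC u) dotZl. Qed.

Lemma dot0r {n} (u : 'rV[R]_n) : dot u 0 = 0.
Proof. by rewrite dotC dot0l. Qed.

Lemma dot_mul_tr {n} (u v : 'rV[R]_n) : dot u v = (u *m v^T) ord0 ord0.
Proof. by rewrite mxE; apply: eq_bigr => i _; rewrite mxE. Qed.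

Lemma dot_row_mx {m n} (u u' : 'rV[R]_m) (v v' : 'rV[R]_n) :
  dot (row_mx u v) (row_mx u' v') = dot u u' + dot v v'.
Proof. by rewrite !dot_mul_tr tr_row_mx mul_row_col mxE. Qed.

Lemma dot_scalar (a b : R) : dot a%:M b%:M = a * b.
Proof. by rewrite /dot big_ord1 !mxE !mulr1n. Qed.

Lemma dot_gt0 {n} (u : 'rV[R]_n) : u != 0 -> 0 < dot u u.
Proof.
move=> u0; rewrite lt_def; apply/andP; split; last first.
  by apply: sumr_ge0 => i _; rewrite -expr2 sqr_ge0.
apply: contra u0 => /eqP /psumr_eq0P uu.
apply/eqP/rowP => i; rewrite mxE; apply/eqP; rewrite -sqrf_eq0 expr2; apply/eqP.
by rewrite uu // => j _; rewrite -expr2 sqr_ge0.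
Qed.

Lemma enorm_gt0 {n} (u : 'rV[R]_n) : u != 0 -> 0 < enorm u.
Proof. by move=> /dot_gt0; rewrite sqrtr_gt0. Qed.

Lemma dot_tangential {n} (nu v w : 'rV[R]_n) :
  dot nu w = 0 -> dot (tangential nu v) w = dot v w.
Proof. by move=> h; rewrite dotBl dotZl h mulr0 subr0. Qed.

Lemma dot_normalized {n} (u : 'rV[R]_n) : u != 0 ->
  dot ((enorm u)^-1 *: u) ((enorm u)^-1 *: u) = 1.
Proof.
move=> u0; rewrite dotZl dotZr mulrA -invfM -expr2 sqr_sqrtr ?ltW ?dot_gt0//.
by rewrite mulVf // gt_eqF // dot_gt0.
Qed.

Lemma dot_combination {m n} (u : 'rV[R]_m) (A : 'M[R]_(m, n)) (w : 'rV[R]_n) :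
  dot (u *m A) w = \sum_i u ord0 i * dot (row i A) w.
Proof.
rewrite dot_mul_tr -mulmxA mxE; apply: eq_bigr => i _.
by rewrite dot_mul_tr -row_mul [row i _ _ _]mxE.
Qed.

(** The orthogonal complement of the k rows of A is a plane, of which m and nu
    form an orthonormal basis.  Thus m, nu and the rows of A form a basis of
    the whole space, and N - dot N m *: m, orthogonal to all of it,
    vanishes. *)
Lemma normal_plane_parallel {k} (m nu N : 'rV[R]_k.+2) (A : 'M[R]_(k, k.+2)) :
  row_free A -> (forall i, dot m (row i A) = 0) ->
  (forall i, dot nu (row i A) = 0) -> (forall i, dot N (row i A) = 0) ->
  dot m m = 1 -> dot nu nu = 1 -> dot m nu = 0 -> dot N nu = 0 ->
  N = dot N m *: m.
Proof.
move=> A_free mA nuA NA mm nn mnu Nnu.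
have rows (w : 'rV[R]_k.+2) (u : 'rV[R]_k) : (forall i, dot w (row i A) = 0) ->
    dot (u *m A) w = 0.
  move=> wA; rewrite dot_combination big1 // => i _.
  by rewrite dotC wA mulr0.
pose B : 'M[R]_(1 + (1 + k), k.+2) := col_mx m (col_mx nu A).
have B_unit : B \in unitmx.
  rewrite -row_free_unit; apply: inj_row_free => u.
  rewrite -[u]hsubmxK -[rsubmx u]hsubmxK.
  move: (lsubmx u) (lsubmx (rsubmx u)) (rsubmx (rsubmx u)) => a b c.
  rewrite !mul_row_col [a]mx11_scalar [b]mx11_scalar !mul_scalar_mx.
  move: (a 0 0) (b 0 0) => {u}{}a {}b comb.
  have a0 : a = 0.
    move: (congr1 (fun z => dot z m) comb).
    by rewrite /= dot0l !dotDl !dotZl mm (dotC nu) mnu (rows m) // => <-; ring.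
  have b0 : b = 0.
    move: (congr1 (fun z => dot z nu) comb).
    by rewrite /= dot0l !dotDl !dotZl nn mnu (rows nu) // => <-; ring.
  move: comb; rewrite a0 b0 !scale0r !add0r => cA.
  have -> : c = 0.
    by apply: (row_free_inj A_free); rewrite cA mul0mx.
  by rewrite !raddf0 !row_mx0.
apply/eqP; rewrite -subr_eq0 -trmx_eq0; apply/eqP.
set w := N - _.
have Bw : B *m w^T = 0.
  have w_row (v : 'rV[R]_k.+2) : dot w v = 0 -> v *m w^T = 0.
    by move=> wv; rewrite [LHS]mx11_scalar -dot_mul_tr dotC wv raddf0.
  rewrite !mul_col_mx !w_row ?dotBl ?dotZl ?mm ?mnu ?Nnu; try ring.
  have -> : A *m w^T = 0.
    apply/row_matrixP => i; rewrite row_mul row0 w_row //.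
    by rewrite dotBl dotZl mA NA mulr0 subr0.
  by rewrite !col_mx0.
by rewrite -[w^T](mulKmx B_unit) Bw mulmx0.
Qed.

Lemma dot3E (u v : 'rV[R]_3) : dot u v =
  u ord0 0 * v ord0 0 + u ord0 1 * v ord0 1 + u ord0 2 * v ord0 2.
Proof.
rewrite /dot !big_ord_recl big_ord0 addr0 !addrA.
by congr (_ * _ + _ * _ + _ * _); congr (_ _ _); apply: val_inj.
Qed.

Lemma cross3E (u v : 'rV[R]_3) :
  (cross u v ord0 0 = u ord0 1 * v ord0 2 - u ord0 2 * v ord0 1) *
  (cross u v ord0 1 = u ord0 2 * v ord0 0 - u ord0 0 * v ord0 2) *
  (cross u v ord0 2 = u ord0 0 * v ord0 1 - u ord0 1 * v ord0 0).
Proof.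
split; first split; rewrite mxE; congr (_ * _ - _ * _); congr (_ _ _);
  exact: val_inj.
Qed.

Lemma eq_rV3 (u v : 'rV[R]_3) : u ord0 0 = v ord0 0 -> u ord0 1 = v ord0 1 ->
  u ord0 2 = v ord0 2 -> u = v.
Proof.
move=> h0 h1 h2; apply/rowP => -[[|[|[|//]]] hj].
- by rewrite (_ : Ordinal hj = 0) //; apply: val_inj.
- by rewrite (_ : Ordinal hj = 1) //; apply: val_inj.
- by rewrite (_ : Ordinal hj = 2) //; apply: val_inj.
Qed.

Lemma dot_cross_l (u v : 'rV[R]_3) : dot u (cross u v) = 0.
Proof. by rewrite dot3E !cross3E; ring. Qed.

Lemma dot_cross_r (u v : 'rV[R]_3) : dot v (cross u v) = 0.
Proof. by rewrite dot3E !cross3E; ring. Qed.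

Lemma dot_cross_cross (u v : 'rV[R]_3) :
  dot (cross u v) (cross u v) = dot u u * dot v v - dot u v ^+ 2.
Proof. by rewrite !dot3E !cross3E; ring. Qed.

Lemma cross_self (u : 'rV[R]_3) : cross u u = 0.
Proof. by apply: eq_rV3; rewrite cross3E mxE; ring. Qed.

Lemma crossZr (a : R) (u v : 'rV[R]_3) : cross u (a *: v) = a *: cross u v.
Proof. by apply: eq_rV3; rewrite !(cross3E, mxE); ring. Qed.

(** Cramer's rule for the frame u, v, cross u v, whose determinant is the
    squared norm of cross u v. *)
Lemma cramer_cross (u v w : 'rV[R]_3) (n := cross u v) :
  dot n n *: w =
  dot w u *: cross v n + dot w v *: cross n u + dot w n *: n.
Proof. by apply: eq_rV3; rewrite !(cross3E, mxE, dot3E); ring. Qed.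

(** In the orthonormal frame u, v, u x v only the u-component of w is left, so w
    is parallel to u. *)
Lemma cross_eq0_frame (u v w : 'rV[R]_3) :
  dot u u = 1 -> dot v v = 1 -> dot u v = 0 ->
  dot w v = 0 -> dot w (cross u v) = 0 -> cross u w = 0.
Proof.
move=> uu vv uv wv wn.
have /= := cramer_cross u v w.
rewrite dot_cross_cross uu vv uv wv wn expr0n subr0 mulr1 !scale1r !scale0r.
rewrite !addr0 => ->.
(* v x (u x v) = u, from the expansion of the double cross product. *)
rewrite crossZr (_ : cross v (cross u v) = u) ?cross_self ?scaler0 //.
transitivity (dot v v *: u - dot u v *: v).
  by apply: eq_rV3; rewrite !(cross3E, mxE, dot3E); ring.
by rewrite uv vv scale1r scale0r subr0.
Qed.

End EuclideanAlgebra.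

(** * Calculus of vector-valued maps *)

Section Calculus.
Context {R : realType}.

Lemma is_derive_mxP {V : normedModType R} {m n} (F : V -> 'M[R]_(m, n))
    (x v : V) (dF : 'M[R]_(m, n)) :
  is_derive x v F dF <->
  forall i j, is_derive x v (fun y => F y i j) (dF i j).
Proof.
split=> [F_dF i j|F_dF].
- have F_der : derivable F x v by exact: ex_derive.
  have <- : 'D_v F x = dF by exact: derive_val.
  rewrite derive_mx // mxE; apply/derivableP.
  by move: F_der => /derivable_mxP.
- have F_der : derivable F x v by apply/derivable_mxP => i j; exact: ex_derive.
  apply: DeriveDef => //; rewrite derive_mx //.
  by apply/matrixP => i j; rewrite mxE; exact: derive_val.
Qed.

Lemma is_derive_dot {V : normedModType R} {n} (f g : V -> 'rV[R]_n) (x v : V)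
    (df dg : 'rV[R]_n) :
  is_derive x v f df -> is_derive x v g dg ->
  is_derive x v (fun y => dot (f y) (g y)) (dot df (g x) + dot (f x) dg).
Proof.
move=> /is_derive_mxP f_df /is_derive_mxP g_dg.
rewrite (_ : (fun y => dot (f y) (g y)) =
    \sum_(i < n) ((fun y => f y ord0 i) * (fun y => g y ord0 i))); last first.
  by apply/funext => y; rewrite fct_sumE.
apply: is_derive_eq; rewrite -big_split; apply: eq_bigr => i _ /=.
by rewrite /GRing.scale /= addrC (mulrC (df _ _)).
Qed.

Lemma is_derive_cross {V : normedModType R} (f g : V -> 'rV[R]_3) (x v : V)
    (df dg : 'rV[R]_3) :
  is_derive x v f df -> is_derive x v g dg ->
  is_derive x v (fun y => cross (f y) (g y)) (cross df (g x) + cross (f x) dg).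
Proof.
move=> /is_derive_mxP f_df /is_derive_mxP g_dg; apply/is_derive_mxP => i k.
rewrite [i]ord1 (_ : (fun y => _) =
    (fun y => f y ord0 (k + 1)) * (fun y => g y ord0 (k + 2)) -
    (fun y => f y ord0 (k + 2)) * (fun y => g y ord0 (k + 1))); last first.
  by apply/funext => y; rewrite mxE.
apply: is_derive_eq; rewrite !mxE /GRing.scale /=; ring.
Qed.

Lemma is_derive_scale_fun {V : normedModType R} {n} (f : V -> R)
    (g : V -> 'rV[R]_n) (x v : V) (df : R) (dg : 'rV[R]_n) :
  is_derive x v f df -> is_derive x v g dg ->
  is_derive x v (fun y => f y *: g y) (df *: g x + f x *: dg).
Proof.
move=> f_df /is_derive_mxP g_dg; apply/is_derive_mxP => i j.
rewrite (_ : (fun y => _) = f * (fun y => g y i j)); last first.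
  by apply/funext => y; rewrite mxE.
by apply: is_derive_eq; rewrite !mxE /GRing.scale /=; ring.
Qed.

Lemma derive_locally_constant {V : normedModType R} (U : set V) (f : V -> R)
    (c : R) (x v : V) : open U -> U x -> (forall y, U y -> f y = c) ->
  forall df, is_derive x v f df -> df = 0.
Proof.
move=> U_open Ux fc df f_df.
have <- : 'D_v f x = df by exact: derive_val.
rewrite (@near_eq_derive _ _ _ f (cst c)) ?derive_cst //.
by apply: filterS (open_nbhs_nbhs (conj U_open Ux)) => y /fc.
Qed.

Lemma dot_derive_unit {V : normedModType R} {n} (U : set V) (f : V -> 'rV[R]_n)
    (x v : V) : open U -> U x -> (forall y, U y -> dot (f y) (f y) = 1) ->
  forall df, is_derive x v f df -> dot (f x) df = 0.
Proof.
move=> U_open Ux ff df f_df.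
have /(_ _ (is_derive_dot _ _ _ _ _ _ f_df f_df)) :=
  derive_locally_constant U (fun y => dot (f y) (f y)) 1 x v U_open Ux ff.
rewrite (dotC df) => h; lra.
Qed.

Lemma is_derive0_interval_constant {n} (I : set R) (f : R -> 'rV[R]_n) :
  is_interval I -> (forall s, I s -> is_derive s 1 f 0) ->
  forall s t, I s -> I t -> f s = f t.
Proof.
move=> I_itv f_0 s t Is It; apply/rowP => j.
wlog st : s t Is It / s < t.
  by move=> hwlog; have [st|ts|->//] := ltgtP s t; [|symmetry]; apply: hwlog.
have I_st r : r \in `[s, t] -> I r.
  by rewrite in_itv /= => /andP[sr rt]; apply: (I_itv s t) => //; rewrite sr.
have fj_0 (r : R) : r \in `[s, t] -> is_derive r 1 (fun y => f y ord0 j) 0.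
  by move=> /I_st/f_0/is_derive_mxP /(_ ord0 j); rewrite mxE.
have fj_cont : {within `[s, t], continuous (fun y => f y ord0 j)}.
  by apply: derivable_within_continuous => r /fj_0 h; exact: ex_derive.
have fj_oo (r : R) : r \in `]s, t[ -> is_derive r 1 (fun y => f y ord0 j) 0.
  by move=> /subset_itv_oo_cc; exact: fj_0.
have [r _ /eqP] := MVT st fj_oo fj_cont.
by rewrite mul0r subr_eq0 => /eqP ->.
Qed.

Lemma derivable_inv_enorm {n} (f : R -> 'rV[R]_n) (s : R) :
  derivable f s 1 -> f s != 0 -> derivable (fun y => (enorm (f y))^-1) s 1.
Proof.
move=> f_der fs0.
have ff_der : derivable (fun y => dot (f y) (f y)) s 1.
  have f_df := derivableP f_der.
  by have h := is_derive_dot _ _ _ _ _ _ f_df f_df; exact: ex_derive.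
have sqrt_der : derivable (Num.sqrt : R -> R) (dot (f s) (f s)) 1.
  by have h := is_derive1_sqrt (dot_gt0 (f s) fs0); exact: ex_derive.
apply: derivableV; first by rewrite gt_eqF // enorm_gt0.
apply/derivable1_diffP.
apply: (@differentiable_comp _ _ _ _ (fun y => dot (f y) (f y)) Num.sqrt);
  exact/derivable1_diffP.
Qed.

(** The class C^k is defined by derivatives taken with the total operator 'D_v,
    which see f outside U as well; openness of U makes them local. *)
Lemma Ck_on_ext {V W : normedModType R} (k : nat) (U : set V) (f g : V -> W) :
  open U -> (forall p, U p -> f p = g p) -> Ck_on k U f -> Ck_on k U g.
Proof.
move=> U_open; have near_U p : U p -> \near p, U p.
  by move=> Up; exact: open_nbhs_nbhs.
elim: k f g => [|k IHk] f g fg /=.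
  move=> f_cont p Up; rewrite /prop_for /continuous_at -fg //.
  apply: cvg_trans (f_cont p Up); apply: near_eq_cvg.
  by apply: filterS (near_U p Up).
move=> f_Ck v; have [f_der Df_Ck] := f_Ck v; split=> [p Up|].
  apply: near_eq_derivable (f_der p Up).
  by apply: filterS (near_U p Up).
apply: IHk Df_Ck => p Up; apply: near_eq_derive.
by apply: filterS (near_U p Up).
Qed.

Lemma continuous_mx {T : topologicalType} {m n} (F : T -> 'M[R]_(m, n)) (p : T) :
  (forall i j, {for p, continuous (fun q => F q i j)}) -> {for p, continuous F}.
Proof.
move=> F_cont A [P P_nbhs PA].
have : \forall q \near p, forall i j, P i j (F q i j).
  apply: filter_forall => i; apply: filter_forall => j.
  exact: (F_cont i j _ (P_nbhs i j)).
by apply: filterS => q Pq; exact: PA.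
Qed.

(** The family contains the chart of the cylinder over f (c = 0, d = 1) and is
    closed under directional derivatives: that is why the vertical coordinate
    is an arbitrary affine function. *)
Definition ruled (f : R -> 'rV[R]_3) (c d : R) (p : 'rV[R]_2) :
  'rV[R]_(3 + 1) := row_mx (f (p ord0 0)) (c + d * p ord0 1)%:M.

(** f is differentiated along v ord0 0 instead of being differentiated along 1
    and rescaled, so that the result is the very function whose regularity is
    part of that of f at the next order. *)
Lemma is_derive_ruled (f : R -> 'rV[R]_3) (c d : R) (p v : 'rV[R]_2) :
  derivable (f : R^o -> _) (p ord0 0) (v ord0 0) ->
  is_derive p v (ruled f c d) (ruled ('D_(v ord0 0 : R^o) f) (d * v ord0 1) 0 p).
Proof.
(* A difference quotient along v of a function of one coordinate is literally
   a one-variable quotient along that coordinate of v. *)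
have coord (W : normedModType R) (h : R -> W) (j : 'I_2) :
    derivable (h : R^o -> _) (p ord0 j) (v ord0 j) ->
    is_derive p v (fun q : 'rV[R]_2 => h (q ord0 j)) ('D_(v ord0 j : R^o) h (p ord0 j)).
  have quotient : (fun t : R => t^-1 *: (((fun q : 'rV[R]_2 => h (q ord0 j)) \o
                     shift p) (t *: v) - h (p ord0 j))) =
      (fun t : R => t^-1 *: ((h \o shift (p ord0 j)) (t *: v ord0 j)
         - h (p ord0 j))).
    by apply/funext => t /=; rewrite !mxE.
  move=> h_der; apply: DeriveDef.
    by rewrite /derivable quotient.
  by rewrite /derive quotient.
move=> f_der; apply/is_derive_mxP => i j; rewrite [i]ord1.
rewrite /ruled; case: (split_ordP j) => k -> {j}.
  rewrite row_mxEl.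
  under eq_fun do rewrite row_mxEl.
  have /is_derive_mxP := coord _ f 0 f_der; exact.
rewrite row_mxEr mul0r addr0 [k]ord1 mxE mulr1n.
under eq_fun do rewrite row_mxEr mxE mulr1n.
have affine_der (x w : R) : is_derive x w (fun t : R => c + d * t) (d * w).
  have h := is_deriveD (is_derive_cst c x w) (is_deriveZ d (is_derive_id x w)).
  by rewrite add0r in h.
rewrite -(@derive_val _ _ _ _ _ _ _ (affine_der (p ord0 1) (v ord0 1))).
by apply: (coord _ (fun t : R => c + d * t) 1); exact: ex_derive.
Qed.

Lemma open_strip (I : set R) : open I -> open [set p : 'rV[R]_2 | I (p ord0 0)].
Proof.
move=> I_open; apply: open_comp I_open => p _; exact: coord_continuous.
Qed.
Lemma Ck_on_ruled (k : nat) (I : set R) (f : R -> 'rV[R]_3) (c d : R) :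
  open I -> Ck_on k (I : set R^o) f ->
  Ck_on k [set p : 'rV[R]_2 | I (p ord0 0)] (ruled f c d).
Proof.
move=> I_open; elim: k f c d => [|k IHk] f c d /=.
  move=> f_cont p Ip; apply: continuous_mx => i j; rewrite [i]ord1 /ruled.
  rewrite /prop_for; case: (split_ordP j) => l -> {j}.
    rewrite (_ : (fun q => _) = (fun u : 'rV[R]_3 => u ord0 l) \o
        (f \o (fun q : 'rV[R]_2 => q ord0 0))); last first.
      by apply/funext => q; rewrite row_mxEl.
    apply: continuous_comp; last exact: coord_continuous.
    by apply: continuous_comp; [exact: coord_continuous|exact: f_cont].
  rewrite (_ : (fun q => _) = (fun q : 'rV[R]_2 => c + d * q ord0 1)); last first.
    by apply/funext => q; rewrite row_mxEr [l]ord1 mxE mulr1n.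
  have y_cont : (fun q : 'rV[R]_2 => q ord0 1) @ p --> p ord0 1.
    exact: coord_continuous.
  exact: cvgD (cvg_cst c) (cvgM (cvg_cst d) y_cont).
move=> f_Ck v; have [f_der Df_Ck] := f_Ck (v ord0 0); split=> [p Ip|].
  by have h := is_derive_ruled f c d p v (f_der _ Ip); exact: ex_derive.
apply: Ck_on_ext (IHk _ (d * v ord0 1) 0 Df_Ck); first exact: open_strip.
move=> p Ip; have h := is_derive_ruled f c d p v (f_der _ Ip).
by rewrite derive_val.
Qed.

End Calculus.

(** * Regular curves and geodesics of S2 *)

Section Curves.
Context {R : realType}.
Context (I : set R) (alpha : R -> 'rV[R]_3).
Context (alpha_reg : regular_curve I alpha).

Let T := unit_tangent alpha.
Let conormal s := cross (alpha s) (T s).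

Lemma is_derive_regular_curve s : I s ->
  is_derive s 1 alpha (derive1 alpha s).
Proof.
have [_ _ _ alpha_smooth _] := alpha_reg.
move=> Is; have [/(_ s Is) alpha_der _] := alpha_smooth 1 1.
by rewrite derive1E; exact: derivableP.
Qed.

Lemma is_derive_velocity s : I s ->
  is_derive s 1 (derive1 alpha) (derive1 (derive1 alpha) s).
Proof.
have [_ _ _ alpha_smooth _] := alpha_reg.
move=> Is; have [_ /(_ 1) [/(_ s Is) velocity_der _]] := alpha_smooth 2 1.
rewrite derive1E; apply: derivableP.
have -> : derive1 alpha = 'D_1 alpha by apply/funext => t; rewrite derive1E.
exact: velocity_der.
Qed.

Lemma regular_curve_S2 s : I s -> dot (alpha s) (alpha s) = 1.
Proof. by move=> Is; have [_ _ _ _ /(_ s Is) []] := alpha_reg. Qed.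

Lemma regular_curve_velocity_neq0 s : I s -> derive1 alpha s != 0.
Proof. by move=> Is; have [_ _ _ _ /(_ s Is) []] := alpha_reg. Qed.

Lemma dot_position_velocity s : I s -> dot (alpha s) (derive1 alpha s) = 0.
Proof.
have [_ I_open _ _ _] := alpha_reg.
move=> Is; apply: (dot_derive_unit I alpha s 1 I_open Is regular_curve_S2).
exact: is_derive_regular_curve.
Qed.

Lemma dot_position_tangent s : I s -> dot (alpha s) (T s) = 0.
Proof. by move=> Is; rewrite dotZr dot_position_velocity // mulr0. Qed.

Lemma dot_tangent s : I s -> dot (T s) (T s) = 1.
Proof. by move=> Is; exact/dot_normalized/regular_curve_velocity_neq0. Qed.

Lemma dot_conormal s : I s -> dot (conormal s) (conormal s) = 1.
Proof.
move=> Is; rewrite dot_cross_cross regular_curve_S2 // dot_tangent //.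
by rewrite dot_position_tangent // expr0n subr0 mulr1.
Qed.

Lemma dot_velocity_conormal s : dot (derive1 alpha s) (conormal s) = 0.
Proof. by rewrite /conormal crossZr dotZr dot_cross_r mulr0. Qed.

(** The derivative c of 1 / |alpha'| is left unspecified: alpha' is orthogonal to
    the conormal, so c drops out of the geodesic curvature. *)
Lemma is_derive_unit_tangent s : I s -> exists c : R,
  is_derive s 1 T (c *: derive1 alpha s
                   + (enorm (derive1 alpha s))^-1 *: derive1 (derive1 alpha) s).
Proof.
move=> Is; have velocity_der := is_derive_velocity s Is.
have inv_der : derivable (fun y => (enorm (derive1 alpha y))^-1) s 1.
  apply: derivable_inv_enorm (regular_curve_velocity_neq0 s Is).
  exact: ex_derive.
exists ('D_1 (fun y => (enorm (derive1 alpha y))^-1) s).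
apply: is_derive_scale_fun; exact: derivableP.
Qed.

(** The tangential projection can be omitted because the conormal is orthogonal
    to alpha. *)
Lemma geodesic_curvatureE s :
  geodesic_curvature alpha s =
  (enorm (derive1 alpha s))^-1 * dot (derive1 T s) (conormal s).
Proof.
by rewrite /geodesic_curvature dotZl dot_tangential ?dot_cross_l.
Qed.

Lemma geodesic_curvature_acceleration s : I s ->
  geodesic_curvature alpha s =
  (enorm (derive1 alpha s)) ^- 2 * dot (derive1 (derive1 alpha) s) (conormal s).
Proof.
move=> Is; rewrite (geodesic_curvatureE s).
have [c T_der] := is_derive_unit_tangent s Is.
rewrite (derive1E T) (@derive_val _ _ _ _ _ _ _ T_der) dotDl !dotZl.
rewrite (dot_velocity_conormal s).
by rewrite mulr0 add0r mulrA -invfM -expr2.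
Qed.

(** The derivative alpha' x T + alpha x T' has its first term zero as T is
    parallel to alpha', and its second term zero as T' is parallel to alpha. *)
Lemma geodesic_conormal_constant : geodesic I alpha ->
  forall s t, I s -> I t -> conormal s = conormal t.
Proof.
have [I_itv I_open _ _ _] := alpha_reg.
move=> alpha_geo; apply: is_derive0_interval_constant => // s Is.
have [c T_der] := is_derive_unit_tangent s Is.
have T'E : 'D_1 T s = _ := @derive_val _ _ _ _ _ _ _ T_der.
have e0 : enorm (derive1 alpha s) != 0.
  by rewrite gt_eqF // enorm_gt0 // regular_curve_velocity_neq0.
rewrite -T'E -derive1E in T_der.
have alpha_der := is_derive_regular_curve s Is.
apply: is_derive_eq (is_derive_cross _ _ _ _ _ _ alpha_der T_der) _.
rewrite {1}/T crossZr cross_self scaler0 add0r.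
apply: (@cross_eq0_frame _ _ (T s)).
- exact: regular_curve_S2.
- exact: dot_tangent.
- exact: dot_position_tangent.
- by rewrite dotC (dot_derive_unit I T s 1 I_open Is dot_tangent _ T_der).
- have /eqP := alpha_geo s Is; rewrite (geodesic_curvatureE s) mulf_eq0.
  by rewrite invr_eq0 (negbTE e0) => /eqP.
Qed.

(** Each conormal is orthogonal to its own point of the curve, and they all
    coincide. *)
Lemma geodesic_great_circle : geodesic I alpha ->
  exists m : 'rV[R]_3, dot m m = 1 /\ forall s, I s -> dot m (alpha s) = 0.
Proof.
have [_ _ [s0 Is0] _ _] := alpha_reg.
move=> alpha_geo; exists (conormal s0); split=> [|s Is]; first exact: dot_conormal.
by rewrite -(geodesic_conormal_constant alpha_geo s s0) // dotC dot_cross_l.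
Qed.

End Curves.

(** * Patches of S2 x R *)

Section Patches.
Context {R : realType}.
Implicit Types (U : set 'rV[R]_2) (X : 'rV[R]_2 -> 'rV[R]_(3 + 1)).

Lemma unit_normal_second_form X p N i j : unit_normal X p N ->
  second_form X p N i j = dot (partial (partial X j) i p) N.
Proof.
by move=> [_ N_nu _]; rewrite mxE dot_tangential // dotC.
Qed.

Lemma mean_curvature0 X p N : second_form X p N = 0 -> mean_curvature X p N 0.
Proof.
move=> II0; exists 0, 0; split; last by rewrite addr0.
rewrite /principal_curvatures /shape_operator II0 mul0mx char_poly_trig.
  by rewrite !big_ord_recl big_ord0 !mxE mulr1.
by apply/is_trig_mxP => i j _; rewrite mxE.
Qed.

Lemma mean_curvature_trace X p N H : mean_curvature X p N H ->
  H = \tr (shape_operator X p N).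
Proof.
move=> [k1 [k2 [AE ->]]]; apply: oppr_inj.
rewrite -char_poly_trace // AE /=.
rewrite (_ : _ * _ = 'X * 'X - (k1 + k2)%:P * 'X + (k1 * k2)%:P).
  by rewrite !coefE /=; ring.
by rewrite polyCD polyCM; ring.
Qed.

Lemma is_derive_patch {U X p} (i : 'I_2) : regular_patch U X -> U p ->
  is_derive p (delta_mx ord0 i) X (partial X i p).
Proof.
move=> [_ X_smooth _ _] Up; apply: derivableP.
by have [/(_ p Up)] := X_smooth 1 (delta_mx ord0 i).
Qed.

Lemma is_derive_partial {U X p} (i j : 'I_2) : regular_patch U X -> U p ->
  is_derive p (delta_mx ord0 i) (partial X j) (partial (partial X j) i p).
Proof.
move=> [_ X_smooth _ _] Up; apply: derivableP.
by have [_ /(_ (delta_mx ord0 i)) [/(_ p Up)]] := X_smooth 2 (delta_mx ord0 j).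
Qed.

Lemma dot_const_derive U (Y : 'rV[R]_2 -> 'rV[R]_(3 + 1)) (m dY : 'rV[R]_(3 + 1))
    (p v : 'rV[R]_2) : open U -> U p -> (forall q, U q -> dot m (Y q) = 0) ->
  is_derive p v Y dY -> dot m dY = 0.
Proof.
move=> U_open Up mY Y_dY.
have h := is_derive_dot _ _ _ _ _ _ (is_derive_cst m p v) Y_dY.
have := derive_locally_constant U _ 0 p v U_open Up mY _ h.
by rewrite dot0l add0r.
Qed.

(** The normal of S2 x R is the spherical part of X, a unit vector on U. *)
Lemma patch_normal_partial U X p i : regular_patch U X -> U p ->
  dot (S2xR_normal (X p)) (partial X i p) = 0.
Proof.
move=> X_reg Up; have X_der := is_derive_patch i X_reg Up.
have [U_open _ X_S2 _] := X_reg.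
have lX_der : is_derive p (delta_mx ord0 i) (fun q => lsubmx (X q))
    (lsubmx (partial X i p)).
  apply/is_derive_mxP => k l; rewrite mxE.
  under eq_fun do rewrite mxE.
  by move/is_derive_mxP: X_der.
have h := dot_derive_unit U _ p _ U_open Up X_S2 _ lX_der.
by rewrite /S2xR_normal -[partial X i p]hsubmxK dot_row_mx h dot0l addr0.
Qed.

(** Differentiating <(m, 0), X> = 0 twice keeps all the derivatives of X
    orthogonal to (m, 0), which is therefore the unit normal up to sign. *)
Lemma patch_in_vertical_hyperplane U X (m : 'rV[R]_3) p N :
  regular_patch U X -> dot m m = 1 ->
  (forall q, U q -> dot m (lsubmx (X q)) = 0) ->
  U p -> unit_normal X p N ->
  dot N (vertical_field R) = 0 /\ second_form X p N = 0.
Proof.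
move=> X_reg mm mX Up N_unit.
have [U_open _ X_S2 J_free] := X_reg; have [NN N_nu N_dX] := N_unit.
pose M : 'rV[R]_(3 + 1) := row_mx m 0.
have MX q : U q -> dot M (X q) = 0.
  by move=> Uq; rewrite -[X q]hsubmxK dot_row_mx dot0l addr0 mX.
have MdX i q : U q -> dot M (partial X i q) = 0.
  move=> Uq.
  exact: (dot_const_derive U X M _ q _ U_open Uq MX (is_derive_patch i X_reg Uq)).
have MddX i j : dot M (partial (partial X j) i p) = 0.
  exact: (dot_const_derive U (partial X j) M _ p _ U_open Up (MdX j)
    (is_derive_partial i j X_reg Up)).
have MM : dot M M = 1 by rewrite dot_row_mx dot0l addr0.
have nunu : dot (S2xR_normal (X p)) (S2xR_normal (X p)) = 1.
  by rewrite dot_row_mx dot0l addr0; exact: X_S2.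
have Mnu : dot M (S2xR_normal (X p)) = 0.
  by rewrite dot_row_mx dot0l addr0 mX.
have NM : N = dot N M *: M.
  apply: (@normal_plane_parallel _ 2 _ (S2xR_normal (X p)) _ (jacobian_rows X p)).
  - exact: J_free.
  - by move=> i; rewrite rowK MdX.
  - by move=> i; rewrite rowK (patch_normal_partial U).
  - by move=> i; rewrite rowK N_dX.
  - exact: MM.
  - exact: nunu.
  - exact: Mnu.
  - exact: N_nu.
split; first by rewrite NM dotZl dot_row_mx dot0l dot0r addr0 mulr0.
apply/matrixP => i j; rewrite unit_normal_second_form // NM dotZr.
by rewrite [dot (partial _ _ _) M]dotC MddX mulr0 mxE.
Qed.

End Patches.

(** * The chart of a vertical surface *)

Section VerticalPatch.
Context {R : realType}.
Context (I : set R) (alpha : R -> 'rV[R]_3).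
Context (alpha_reg : regular_curve I alpha).

Let X := ruled alpha 0 1.
Let U := [set p : 'rV[R]_2 | I (p ord0 0)].

Lemma ord2_ind (P : 'I_2 -> Prop) : P 0 -> P 1 -> forall i, P i.
Proof.
move=> P0 P1 [[|[|//]] hi].
- by rewrite (_ : Ordinal hi = 0) //; apply: val_inj.
- by rewrite (_ : Ordinal hi = 1) //; apply: val_inj.
Qed.

Lemma partial_ruled (f : R -> 'rV[R]_3) (c d : R) (i : 'I_2) (p : 'rV[R]_2) :
  derivable (f : R^o -> _) (p ord0 0) (i == 0)%:R ->
  partial (ruled f c d) i p =
  ruled ('D_((i == 0)%:R : R^o) f) (d * (i == 1)%:R) 0 p.
Proof.
have coord (k : 'I_2) : (i == k)%:R = (delta_mx ord0 i : 'rV[R]_2) ord0 k.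
  by rewrite mxE eqxx /= eq_sym.
rewrite !coord => f_der.
exact: (@derive_val _ _ _ _ _ _ _ (is_derive_ruled f c d p _ f_der)).
Qed.

Lemma partial_vertical_patch0 p : U p ->
  partial X 0 p = row_mx (derive1 alpha (p ord0 0)) 0.
Proof.
move=> Up; have alpha_der := is_derive_regular_curve _ _ alpha_reg _ Up.
rewrite partial_ruled; last exact: ex_derive.
by rewrite /ruled -derive1E !mulr0 mul0r addr0 raddf0.
Qed.

Lemma partial_vertical_patch1 p : partial X 1 p = row_mx 0 1%:M.
Proof.
rewrite partial_ruled; last first.
  by have h := is_derive0 (alpha : R^o -> _) (p ord0 0); exact: ex_derive.
by rewrite /ruled derive0 mulr1 mul0r addr0.
Qed.

Lemma partial2_vertical_patch p i j : U p ->
  partial (partial X j) i p =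
  row_mx (if (i == 0) && (j == 0) then derive1 (derive1 alpha) (p ord0 0)
          else 0) 0.
Proof.
have [_ I_open _ alpha_smooth _] := alpha_reg.
move=> Up.
have [alpha_der /(_ (i == 0)%:R) [Dalpha_der _]] := alpha_smooth 2%N (j == 0)%:R.
rewrite /partial (@near_eq_derive _ _ _ (partial X j)
    (ruled ('D_((j == 0)%:R : R^o) alpha) (1 * (j == 1)%:R) 0)); last first.
  have := open_nbhs_nbhs (conj (open_strip I I_open) Up).
  by apply: filterS => q Uq; exact/partial_ruled/alpha_der.
rewrite -/(partial _ i p) partial_ruled; last exact: Dalpha_der.
rewrite /ruled !mul0r addr0 raddf0; congr row_mx.
move: i j {alpha_der Dalpha_der} => /=; apply: ord2_ind; apply: ord2_ind => /=.
- have -> : 'D_(1 : R^o) alpha = derive1 alpha.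
    by apply/funext => t; rewrite derive1E.
  by rewrite derive1E.
- have -> : 'D_(0 : R^o) alpha = cst 0 by apply/funext => t; rewrite derive0.
  exact: derive_cst.
- exact: derive0.
- exact: derive0.
Qed.

Lemma vertical_patch_regular : regular_patch U X.
Proof.
have [_ I_open _ alpha_smooth _] := alpha_reg.
split.
- exact: open_strip.
- by move=> k; exact: Ck_on_ruled.
- move=> p Up; rewrite /S2xR /= row_mxKl.
  exact: regular_curve_S2 alpha_reg _ Up.
- move=> p Up; apply: inj_row_free => v v0.
  have velocity0 := regular_curve_velocity_neq0 _ _ alpha_reg _ Up.
  have : v ord0 0 *: row_mx (derive1 alpha (p ord0 0)) 0
       + v ord0 1 *: row_mx 0 1%:M = 0 :> 'rV[R]_(3 + 1).
    rewrite -v0 mulmx_sum_row big_ord_recl big_ord1 !rowK.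
    rewrite -(partial_vertical_patch0 _ Up) -(partial_vertical_patch1 p).
    by congr (_ + v _ _ *: partial _ _ _); apply: val_inj.
  rewrite !scale_row_mx add_row_mx !scaler0 addr0 add0r => comb.
  have /eqP := congr1 lsubmx comb.
  rewrite row_mxKl raddf0 scaler_eq0 (negbTE velocity0) orbF => /eqP v00.
  have /matrixP/(_ ord0 ord0) := congr1 rsubmx comb.
  rewrite row_mxKr !mxE mulr1 => v01.
  by apply/rowP; apply: ord2_ind; rewrite mxE.
Qed.

Lemma vertical_patch_unit_normal p : U p ->
  unit_normal X p (row_mx (cross (alpha (p ord0 0))
                                 (unit_tangent alpha (p ord0 0))) 0).
Proof.
move=> Up; split.
- by rewrite dot_row_mx dot0l addr0 (dot_conormal _ _ alpha_reg _ Up).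
- by rewrite dot_row_mx dot0l addr0 row_mxKl dotC dot_cross_l.
- apply: ord2_ind.
    rewrite (partial_vertical_patch0 _ Up) dot_row_mx dot0l addr0 dotC.
    exact: dot_velocity_conormal.
  by rewrite partial_vertical_patch1 dot_row_mx dot0l dot0r addr0.
Qed.

(** Both fundamental forms are diagonal in the chart, with entries |alpha'|^2, 1
    and <alpha'', n>, 0; the trace of the shape operator is the quotient of
    their first entries. *)
Lemma vertical_patch_mean_curvature p H : U p ->
  mean_curvature X p (row_mx (cross (alpha (p ord0 0))
                                    (unit_tangent alpha (p ord0 0))) 0) H ->
  H = geodesic_curvature alpha (p ord0 0).
Proof.
move=> Up /mean_curvature_trace ->.
set s := p ord0 0; set n := cross _ _; set N := row_mx n 0.
pose g := dot (derive1 alpha s) (derive1 alpha s).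
pose x := dot (derive1 (derive1 alpha) s) n.
have velocity0 := regular_curve_velocity_neq0 _ _ alpha_reg _ Up.
have g_gt0 : 0 < g by exact: dot_gt0.
have g_neq0 : g != 0 by rewrite gt_eqF.
have GE : first_form X p = diag_mx (\row_j (if j == 0 then g else 1)).
  apply/matrixP; apply: ord2_ind; apply: ord2_ind; rewrite !mxE /=;
    rewrite ?(partial_vertical_patch0 _ Up) ?partial_vertical_patch1 dot_row_mx;
    by rewrite ?dot0l ?dot0r ?dot_scalar ?mulr1 ?addr0 ?add0r.
have IIE : second_form X p N = diag_mx (\row_j (if j == 0 then x else 0)).
  apply/matrixP => i j; rewrite (unit_normal_second_form _ _ _ _ _
    (vertical_patch_unit_normal _ Up)) partial2_vertical_patch //.
  rewrite dot_row_mx dot0l addr0; move: i j.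
  by apply: ord2_ind; apply: ord2_ind; rewrite !mxE //= ?dot0l.
have shapeE : shape_operator X p N =
    diag_mx (\row_j (if j == 0 then x / g else 0)).
  rewrite /shape_operator IIE GE.
  (* Factoring out the first form avoids computing its inverse. *)
  rewrite (_ : diag_mx (\row_j (if j == 0 then x else 0)) =
    diag_mx (\row_j (if j == 0 then x / g else 0)) *m
    diag_mx (\row_j (if j == 0 then g else 1))).
    rewrite mulmxK // unitmxE det_diag big_ord_recl big_ord1 !mxE /= mulr1.
    by rewrite unitfE.
  rewrite mulmx_diag; congr diag_mx; apply/rowP => j; rewrite !mxE.
  by case: ifP => _; rewrite ?mul0r // divfK.
rewrite shapeE mxtrace_diag big_ord_recl big_ord1 !mxE /= addr0.
rewrite (geodesic_curvature_acceleration _ _ alpha_reg _ Up).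
by rewrite /enorm sqr_sqrtr ?ltW // mulrC.
Qed.

End VerticalPatch.

(** * Vertical solitons *)

Theorem theorem3p2 (R : realType) (Sigma : set 'rV[R]_(3 + 1))
    (I : set R) (alpha : R -> 'rV[R]_3)
    (hSigma : vertical_surface_on Sigma I alpha) :
  V_soliton Sigma <->
  (geodesic I alpha /\
   exists (J : set R) (beta : R -> 'rV[R]_3),
     vertical_surface_on Sigma J beta /\ geodesic J beta).
Proof.
have [_ [alpha_reg SigmaE]] := hSigma.
split=> [soliton|[alpha_geo _]].
- suff alpha_geo : geodesic I alpha by split=> //; exists I, alpha.
  move=> s Is; pose p : 'rV[R]_2 := const_mx s.
  have ps : p ord0 0 = s by rewrite mxE.
  have Up : I (p ord0 0) by rewrite ps.
  have X_Sigma : ruled alpha 0 1 @` [set q : 'rV[R]_2 | I (q ord0 0)] `<=` Sigma.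
    move=> _ [q Iq <-]; rewrite SigmaE; exists (q ord0 0) => //.
    by exists (q ord0 1) => //; rewrite /ruled add0r mul1r.
  have := soliton _ _ (vertical_patch_regular _ _ alpha_reg) X_Sigma p _ Up
    (vertical_patch_unit_normal _ _ alpha_reg _ Up).
  move=> /(vertical_patch_mean_curvature _ _ alpha_reg _ _ Up).
  by rewrite dot_row_mx dot0l dot0r addr0 ps => <-.
- have [m [mm m_alpha]] := geodesic_great_circle _ _ alpha_reg alpha_geo.
  move=> U X X_reg X_Sigma p N Up N_unit.
  have mX q : U q -> dot m (lsubmx (X q)) = 0.
    move=> Uq; have : Sigma (X q) by apply: X_Sigma; exists q.
    by rewrite SigmaE => -[s Is [t _ <-]]; rewrite row_mxKl m_alpha.
  have [NV II0] := patch_in_vertical_hyperplane U X m p N X_reg mm mX Up N_unit.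
  by rewrite NV; exact: mean_curvature0.
Qed.
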